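(* Let $d \geq 2$ and $n,k \geq 0$ be integers. Then the number of $d$-ary operator monomials $M \in \mathcal{M}_d$ with $\operatorname{topt}(M) = n$ and $\operatorname{lopt}(M) = k$ equals \[ N_d(n,k) = \frac{1}{n+1} \binom{n+1}{k+1} \binom{ n + (n-k)(d-2)+1}{k}. \]
   Context: Let $\mathcal{A}$ be an associative $d$-ary algebra: a vector space with a multilinear product $(a_1,\dots,a_d)\mapsto a_1\cdots a_d$ satisfying $d$-ary associativity, $a_1 \cdots a_i ( a_{i+1} \cdots a_{i+d} ) a_{i+d+1} \cdots a_{2d-1} = a_1 \cdots a_j ( a_{j+1} \cdots a_{j+d} ) a_{j+d+1} \cdots a_{2d-1}$ for all $0\le i<j\le d-1$, so that parentheses in iterated products may be removed unambiguously. Let $L$ be a linear operator on $\mathcal{A}$. The set $\mathcal{M}_d$ of ($d$-ary) operator monomials is defined recursively: a single indeterminate is an operator monomial; if $M_1,\dots,M_d$ are operator monomials then the product $M_1\cdots M_d$ is one; if $M$ is one then $L(M)$ is one. Monomials are regarded as formal expressions with the $d$-ary product parentheses removed (identified up to $d$-ary associativity) and with indeterminates named $a_1,a_2,\dots$ from left to right; equivalently, an operator monomial is either a single indeterminate, or $L(M')$ with $M'$ an operator monomial, or a concatenation $M_1 M_2\cdots M_\ell$ with $\ell \equiv 1 \pmod{d-1}$, $\ell\ge d$, where each $M_i$ is either a single indeterminate or of the form $L(M_i')$. For example, for $d=3$ the monomials with $3$ total operations include $a_1a_2a_3a_4a_5a_6a_7$, $L(a_1a_2a_3)a_4a_5$,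 $L(L(a_1))a_2a_3$, $L(L(L(a_1)))$. For $M\in\mathcal{M}_d$, $\operatorname{topt}(M)$ is the total number of operations in $M$ (occurrences of $L$ plus number of applications of the $d$-ary product; a monomial with $m$ indeterminates uses $(m-1)/(d-1)$ products), and $\operatorname{lopt}(M)$ is the number of occurrences of $L$. *)

(* Defs.v *)
From HB Require Import structures.
From mathcomp Require Import all_boot all_order all_algebra.

Set Implicit Arguments.
Unset Strict Implicit.
Unset Printing Implicit Defensive.

(* An expression whose product parentheses have been removed is the sequence  *)
(* of its factors, so that the product is concatenation and d-ary             *)
(* associativity holds by construction. The indeterminates are named a_1,     *)
(* a_2, ... from left to right: the position of an indeterminate determines   *)
(* its name, which is therefore not recorded.                                 *)
Inductive factor : Type :=
| Indet
| Lapp of seq factor.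

Notation expr := (seq factor).

Fixpoint factor_encode (f : factor) : GenTree.tree unit :=
  if f is Lapp M then GenTree.Node 0 (map factor_encode M)
  else GenTree.Leaf tt.

Fixpoint factor_decode (t : GenTree.tree unit) : factor :=
  if t is GenTree.Node _ ts then Lapp (map factor_decode ts) else Indet.

Lemma factor_encodeK : cancel factor_encode factor_decode.
Proof.
rewrite /cancel; fix IH 1; case=> [|M] //=; congr Lapp.
by elim: M => [|f M IHM] //=; rewrite IH IHM.
Qed.

HB.instance Definition _ := Countable.copy factor (can_type factor_encodeK).

Inductive opmonomial (d : nat) : expr -> Prop :=
| OpIndet : opmonomial d [:: Indet]
| OpProd (Ms : d.-tuple expr) :
    (forall M, M \in Ms -> opmonomial d M) -> opmonomial d (flatten Ms)
| OpL (M : expr) : opmonomial d M -> opmonomial d [:: Lapp M].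

Fixpoint flopt (f : factor) : nat :=
  if f is Lapp M then (sumn (map flopt M)).+1 else 0.

Definition lopt (M : expr) : nat := sumn (map flopt M).

Fixpoint findets (f : factor) : nat :=
  if f is Lapp M then sumn (map findets M) else 1.

Definition indets (M : expr) : nat := sumn (map findets M).

(* A monomial with m indeterminates uses (m - 1) / (d - 1) products; the      *)
(* lemmas topt_indet, topt_prod and topt_L below show that topt indeed counts *)
(* the operations.                                                            *)
Definition topt (d : nat) (M : expr) : nat :=
  lopt M + (indets M).-1 %/ d.-1.

Lemma indets_flatten (Ms : seq expr) :
  indets (flatten Ms) = \sum_(M <- Ms) indets M.
Proof.
elim: Ms => [|M Ms IH] /=; first by rewrite big_nil.
by rewrite big_cons -IH /indets map_cat sumn_cat.
Qed.

Lemma lopt_flatten (Ms : seq expr) :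
  lopt (flatten Ms) = \sum_(M <- Ms) lopt M.
Proof.
elim: Ms => [|M Ms IH] /=; first by rewrite big_nil.
by rewrite big_cons -IH /lopt map_cat sumn_cat.
Qed.

Lemma indets_sum (d : nat) (Ms : seq expr) :
  (forall M, M \in Ms -> exists q, indets M = (q * d.-1).+1) ->
  \sum_(M <- Ms) indets M
    = (\sum_(M <- Ms) (indets M).-1 %/ d.-1) * d.-1 + size Ms.
Proof.
move=> H; rewrite big_distrl -sum1_size -big_split /=.
apply: eq_big_seq => M /H[q ->] /=.
case: d.-1 => [|e]; first by rewrite !muln0.
by rewrite mulnK // addn1.
Qed.

Lemma opmonomial_indets (d : nat) (M : expr) : 2 <= d ->
  opmonomial d M -> exists q, indets M = (q * d.-1).+1.
Proof.
move=> d_ge2; elim=> [|Ms _ IH|M' _ [q qE]]; first by exists 0.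
- rewrite indets_flatten (indets_sum IH) size_tuple.
  exists (\sum_(M <- Ms) (indets M).-1 %/ d.-1).+1.
  by case: d d_ge2 {IH} Ms => // d' _ Ms; rewrite mulSn /= addnS addnC.
- by exists q; rewrite -qE /indets /= addn0.
Qed.

Lemma topt_indet (d : nat) : topt d [:: Indet] = 0.
Proof. by rewrite /topt /= div0n. Qed.

Lemma topt_L (d : nat) (M : expr) : topt d [:: Lapp M] = (topt d M).+1.
Proof. by rewrite /topt /lopt /indets /= !addn0. Qed.

Lemma topt_prod (d : nat) (Ms : d.-tuple expr) : 2 <= d ->
  (forall M, M \in Ms -> opmonomial d M) ->
  topt d (flatten Ms) = (\sum_(M <- Ms) topt d M).+1.
Proof.
move=> d_ge2 H; rewrite /topt lopt_flatten indets_flatten big_split /=.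
have {}H M : M \in Ms -> exists q, indets M = (q * d.-1).+1.
  by move/H/(opmonomial_indets d_ge2).
rewrite (indets_sum H) size_tuple -addnS; congr addn.
have d1 : 0 < d.-1 by case: d d_ge2 {H Ms} => [|[]].
rewrite -[in X in (_ + X).-1](prednK (ltnW d_ge2)) addnS /=.
by rewrite divnMDl // divnn d1 addn1.
Qed.

(* Main.v *)
(* A monomial is a nonempty plane forest whose number of roots, like the      *)
(* arity of each of its L-nodes, is congruent to 1 modulo e = d - 1; one more *)
(* L makes it a single tree. Deleting the first root of a forest with n + 1   *)
(* nodes, r + 1 roots and k + 1 L-nodes leaves a forest with n nodes: one     *)
(* with r roots if that root was an indeterminate, one with r + j roots and k *)
(* L-nodes if it was an L-node of arity j. As n does not depend on j,         *)
(* induction on n shows that the number F of forests with r roots, k L-nodes  *)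
(* and n = k + r + p * e nodes satisfies the cycle lemma                      *)
(*   n * F = r * 'C(n, k) * #(weak compositions of p into k parts).           *)
(* The sum over j only involves the average of the first part of a weak       *)
(* composition of p into k + 1 parts, which is p / (k + 1) by symmetry. The   *)
(* theorem is the case r = 1.                                                 *)
Require Import Defs.
From mathcomp Require Import all_boot all_order all_algebra.
From mathcomp Require Import zify ring.

Set Implicit Arguments.
Unset Strict Implicit.
Unset Printing Implicit Defensive.

Import GRing.Theory Num.Theory.

Lemma lopt_cat M N : lopt (M ++ N) = lopt M + lopt N.
Proof. by rewrite /lopt map_cat sumn_cat. Qed.

Lemma indets_cat M N : indets (M ++ N) = indets M + indets N.
Proof. by rewrite /indets map_cat sumn_cat. Qed.

Lemma lopt_cons f M : lopt (f :: M) = flopt f + lopt M. Proof. by []. Qed.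

Lemma indets_cons f M : indets (f :: M) = findets f + indets M.
Proof. by []. Qed.

Lemma lopt_Lapp N M : lopt (Lapp N :: M) = (lopt (N ++ M)).+1.
Proof. by rewrite lopt_cat. Qed.

Lemma indets_Lapp N M : indets (Lapp N :: M) = indets (N ++ M).
Proof. by rewrite indets_cat. Qed.

Lemma size_le_nodes M : size M <= lopt M + indets M.
Proof. by elim: M => // -[|N] M; rewrite lopt_cons indets_cons /=; lia. Qed.

Fixpoint arities_in (D : pred nat) (f : factor) : bool :=
  if f is Lapp M then D (size M) && all (arities_in D) M else true.

Lemma factor_mem_ind (P : factor -> Prop) :
  P Indet -> (forall M, (forall f, f \in M -> P f) -> P (Lapp M)) ->
  forall f, P f.
Proof.
move=> PI PL; fix IH 1; case=> [//|M]; apply: PL.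
elim: M => [|g M IHM] f; first by clear IH.
by rewrite inE => /predU1P[->|/IHM]; first apply: IH.
Qed.

Definition product_length (e : nat) : pred nat :=
  [pred l | (0 < l) && (e %| l.-1)].

Lemma product_lengthP e l :
  reflect (exists q, l = (q * e).+1) (product_length e l).
Proof.
apply: (iffP andP) => [[l_gt0 /dvdnP[q qE]]|[q ->]]; last by rewrite dvdn_mull.
by exists q; rewrite -qE prednK.
Qed.

Lemma product_length1 e : product_length e 1.
Proof. exact: dvdn0. Qed.

Lemma sumn_product_length e s :
  all (product_length e) s -> exists q, sumn s = q * e + size s.
Proof.
elim: s => [|l s IHs] /=; first by exists 0.
case/andP=> /product_lengthP[j ->] /IHs[q ->].
by exists (j + q); rewrite mulnDl addnS addSn addnA.
Qed.

Lemma opmonomial_arities d M : 2 <= d ->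
  opmonomial d M -> arities_in (product_length d.-1) (Lapp M).
Proof.
move=> d_ge2; elim=> [|Ms _ IH|N _ IH]; first by rewrite /= product_length1.
  apply/andP; split; last first.
    by apply/allP=> f /flattenP[N /IH/andP[_ /allP]]; apply.
  have [|q] := @sumn_product_length d.-1 (shape Ms).
    by rewrite all_map; apply/allP => N /IH/andP[].
  rewrite -size_flatten size_map size_tuple => ->.
  apply/product_lengthP; exists q.+1.
  by rewrite mulSn addnC -addSn prednK // ltnW.
by move: IH; rewrite /= product_length1 andbT.
Qed.

Lemma opmonomial_of_factors d M : 2 <= d -> product_length d.-1 (size M) ->
  (forall f, f \in M -> opmonomial d [:: f]) -> opmonomial d M.
Proof.
move=> d_ge2 /product_lengthP[q]; elim: q M => [|q IHq] M szM opM.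
  by case: M szM opM => [|f [|]] // _; apply; rewrite mem_head.
rewrite mulSn -addnS in szM.
pose Ms := rcons [seq [:: f] | f <- take d.-1 M] (drop d.-1 M).
have szMs : size Ms == d.
  rewrite size_rcons size_map size_takel ?szM ?leq_addr //.
  by rewrite prednK // ltnW.
have -> : M = flatten (Tuple szMs).
  by rewrite /= /Ms flatten_rcons flatten_seq1 cat_take_drop.
apply: OpProd => N; rewrite mem_rcons inE => /predU1P[->|/mapP[f fM ->]].
  by apply: IHq => [|f /mem_drop/opM//]; rewrite size_drop szM addKn.
exact/opM/(mem_take fM).
Qed.

Lemma opmonomialP d M : 2 <= d ->
  reflect (opmonomial d M) (arities_in (product_length d.-1) (Lapp M)).
Proof.
move=> d_ge2; apply: (iffP idP) => [|/(opmonomial_arities d_ge2)//].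
have opL N :
    (forall f, f \in N ->
       arities_in (product_length d.-1) f -> opmonomial d [:: f]) ->
    arities_in (product_length d.-1) (Lapp N) -> opmonomial d N.
  move=> opN /andP[szN /allP aritiesN].
  by apply: opmonomial_of_factors szN _ => // f fN; apply/opN/aritiesN.
apply: (opL) => f _; elim/factor_mem_ind: f => [_|N IH]; first exact: OpIndet.
by move/opL=> opN; apply/OpL/opN.
Qed.

Definition graft (l : nat) (M : expr) : expr := Lapp (take l M) :: drop l M.

Lemma graft_eq l X N M : l <= size X ->
  (graft l X == Lapp N :: M) = (l == size N) && (X == N ++ M).
Proof.
move=> leX; apply/eqP/andP => [[<- <-]|[/eqP-> /eqP->]].
  by rewrite size_takel // cat_take_drop.
by rewrite /graft take_size_cat // drop_size_cat.
Qed.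

Lemma graft_inj i j M N : i <= size M -> j <= size N ->
  graft i M = graft j N -> i = j /\ M = N.
Proof.
move=> leM leN /eqP; rewrite graft_eq // size_takel // cat_take_drop.
by case/andP=> /eqP-> /eqP->.
Qed.

Lemma mem_graft_allpairs (s : seq nat) (T : nat -> seq expr) N M :
    (forall j X, X \in T j -> j <= size X) ->
  (Lapp N :: M \in [seq graft j X | j <- s, X <- T j]) =
    (size N \in s) && (N ++ M \in T (size N)).
Proof.
move=> le_size; apply/allpairsPdep/andP => [[j [X [js XT /esym/eqP]]]|[Ns NMT]].
  by rewrite graft_eq ?le_size // => /andP[/eqP<- /eqP<-].
exists (size N), (N ++ M); split=> //.
by apply/esym/eqP; rewrite graft_eq ?le_size // !eqxx.
Qed.

Lemma uniq_graft_allpairs (s : seq nat) (T : nat -> seq expr) :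
    uniq s -> (forall j, uniq (T j)) ->
    (forall j X, X \in T j -> j <= size X) ->
  uniq [seq graft j X | j <- s, X <- T j].
Proof.
move=> uniq_s uniq_T le_size; apply: allpairs_uniq_dep => // _ _
  /allpairsPdep[i [M [_ MT ->]]] /allpairsPdep[j [N [_ NT ->]]] /=.
by case/graft_inj; rewrite ?le_size // => -> ->.
Qed.

Section Forests.

Variable D : pred nat.

Definition is_forest (n r k : nat) (M : expr) : bool :=
  [&& size M == r, lopt M + indets M == n, lopt M == k & all (arities_in D) M].

Lemma is_forest_Indet n r k M :
  is_forest n.+1 r.+1 k (Indet :: M) = is_forest n r k M.
Proof. by rewrite /is_forest lopt_cons indets_cons addnCA. Qed.

Lemma is_forest_Lapp n r k N M :
  is_forest n.+1 r.+1 k.+1 (Lapp N :: M) =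
    D (size N) && is_forest n (size N + r) k (N ++ M).
Proof.
rewrite /is_forest lopt_Lapp indets_Lapp size_cat eqn_add2l all_cat /=.
by rewrite addSn !eqSS; case: (D _); rewrite ?andbF.
Qed.

(* The bound j <= n is harmless, since a forest with n nodes has at most n
   roots (size_le_nodes). *)
Fixpoint forests (n r k : nat) : seq expr :=
  match n, r with
  | 0, 0 => if k is 0 then [:: [::]] else [::]
  | n'.+1, r'.+1 =>
      [seq Indet :: M | M <- forests n' r' k] ++
      if k is k'.+1 then
        [seq graft j M | j <- [seq j <- iota 0 n'.+1 | D j],
                         M <- forests n' (j + r') k']
      else [::]
  | _, _ => [::]
  end.

Arguments forests : simpl never.

Lemma forestsS0 n r :
  forests n.+1 r.+1 0 = [seq Indet :: M | M <- forests n r 0].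
Proof. exact: cats0. Qed.

Lemma forestsSS n r k :
  forests n.+1 r.+1 k.+1 = [seq Indet :: M | M <- forests n r k.+1] ++
    [seq graft j M | j <- [seq j <- iota 0 n.+1 | D j],
                     M <- forests n (j + r) k].
Proof. by []. Qed.

Lemma mem_forests n r k M : (M \in forests n r k) = is_forest n r k M.
Proof.
elim: n r k M => [|n IHn] [|r] k M.
- by case: k M => [|k] [|[|N] M].
- apply/esym/negP => /and3P[/eqP szM /eqP nodesM _].
  by have := size_le_nodes M; rewrite szM nodesM.
- by case: M.
have mem_Indet N : (Indet :: N \in [seq Indet :: M | M <- forests n r k]) =
    is_forest n.+1 r.+1 k (Indet :: N).
  by rewrite is_forest_Indet -IHn mem_map // => ? ? [].
case: k mem_Indet => [|k] mem_Indet.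
  rewrite forestsS0; case: M => [|[|N] M]; rewrite ?mem_Indet //.
    by apply/mapP => -[].
  by rewrite /is_forest lopt_Lapp /= !andbF; apply/mapP => -[].
rewrite forestsSS mem_cat; case: M => [|[|N] M]; rewrite ?mem_Indet.
- by rewrite (introF mapP) => [|[]//]; apply/allpairsPdep => -[? [? []]].
- by rewrite orbC; case: allpairsPdep => // -[? [? []]].
rewrite (introF mapP) => [|[]//]; rewrite is_forest_Lapp -IHn.
rewrite mem_graft_allpairs => [|j X]; last first.
  by rewrite IHn => /andP[/eqP-> _]; rewrite leq_addr.
rewrite mem_filter mem_iota ltnS; case: (D _) => //=.
apply: andb_idl; rewrite IHn => /and3P[_ /eqP <- _].
by apply: leq_trans (size_le_nodes _); rewrite size_cat leq_addr.
Qed.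

Lemma size_mem_forests n r k M : M \in forests n r k -> size M = r.
Proof. by rewrite mem_forests => /andP[/eqP]. Qed.

Lemma uniq_forests n r k : uniq (forests n r k).
Proof.
elim: n r k => [|n IHn] [|r] [|k] //.
  by rewrite forestsS0 map_inj_uniq // => ? ? [].
rewrite forestsSS cat_uniq; apply/and3P; split.
- by rewrite map_inj_uniq // => ? ? [].
- by apply/hasPn=> _ /allpairsPdep[j [N [_ _ ->]]]; apply/mapP=> -[].
apply: uniq_graft_allpairs; rewrite ?filter_uniq ?iota_uniq // => j X.
by move/size_mem_forests->; rewrite leq_addr.
Qed.

Lemma size_forests0 n r : size (forests n r 0) = (n == r).
Proof. by elim: n r => [|n IHn] [|r] //; rewrite forestsS0 size_map IHn. Qed.

Lemma size_forestsSS n r k :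
  size (forests n.+1 r.+1 k.+1) = size (forests n r k.+1) +
    \sum_(0 <= j < n.+1 | D j) size (forests n (j + r) k).
Proof.
rewrite forestsSS size_cat size_map size_allpairs_dep.
by rewrite sumnE big_map big_filter.
Qed.

Lemma size_forests_eq0 n r k : ~~ D 0 -> n < k + r ->
  size (forests n r k) = 0.
Proof.
move=> D0; elim: n r k => [|n IHn] [|r] [|k] // lt_n.
  by rewrite size_forests0 ltn_eqF.
rewrite size_forestsSS IHn ?big1 //; last by lia.
by move=> [|j] Dj; [rewrite Dj in D0 | rewrite IHn //; lia].
Qed.

End Forests.

Definition weak_compositions (k p : nat) : nat := 'C((p + k).-1, p).

Lemma weak_compositions0 p : weak_compositions 0 p = (p == 0).
Proof. by case: p => // p; rewrite /weak_compositions addn0 bin_small. Qed.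

Lemma weak_compositionsE k p : weak_compositions k.+1 p = 'C(p + k, p).
Proof. by rewrite /weak_compositions addnS. Qed.

Lemma sum_weak_compositions k p :
  \sum_(0 <= i < p.+1) weak_compositions k (p - i) = weak_compositions k.+1 p.
Proof.
elim: p => [|p IHp]; first by rewrite big_nat1 /weak_compositions !bin0.
rewrite big_nat_recl // subn0 IHp !weak_compositionsE /weak_compositions.
by rewrite addSn.
Qed.

Lemma sum_mul_weak_compositions k p :
  k.+1 * (\sum_(0 <= i < p.+1) i * weak_compositions k (p - i)) =
    p * weak_compositions k.+1 p.
Proof.
elim: p => [|p IHp]; first by rewrite big_nat1 mul0n muln0.
rewrite big_nat_recl // add0n.
under eq_bigr => i _ do rewrite subSS mulSn.
rewrite big_split /= sum_weak_compositions mulnDr IHp !weak_compositionsE.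
by rewrite -mulnDl addnC addnS addSn -mul_bin_diag.
Qed.

Lemma sum_affine_weak_compositions a b k p :
  k.+1 * (\sum_(0 <= i < p.+1) (a + b * i) * weak_compositions k (p - i)) =
    (a * k.+1 + b * p) * weak_compositions k.+1 p.
Proof.
under eq_bigr => i _ do rewrite mulnDl -mulnA.
rewrite big_split -!big_distrr /= sum_weak_compositions mulnDr mulnCA.
by rewrite [k.+1 * (b * _)]mulnCA sum_mul_weak_compositions; ring.
Qed.

Lemma sum_product_length e p m F : 0 < e -> (p * e).+1 < m ->
    (forall j, (p * e).+1 < j -> F j = 0) ->
  \sum_(0 <= j < m | product_length e j) F j =
    \sum_(0 <= i < p.+1) F (i * e).+1.
Proof.
move=> e_gt0 lt_m F0; rewrite (big_cat_nat _ lt_m) //=.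
rewrite [X in _ + X]big_nat_cond [X in _ + X]big1 ?addn0 => [|j]; last first.
  by case/andP=> /andP[/F0].
rewrite -big_filter -(big_map (fun i => (i * e).+1) predT); apply: perm_big.
have mul_inj : injective (fun i => (i * e).+1).
  by move=> i j [/eqP]; rewrite eqn_pmul2r // => /eqP.
apply: uniq_perm => [||j]; rewrite ?filter_uniq ?map_inj_uniq ?iota_uniq //.
rewrite mem_filter; apply/andP/mapP => [[/product_lengthP[i ->]]|[i + ->]].
  by rewrite mem_iota !ltnS leq_pmul2r // => le_ip; exists i; rewrite ?mem_iota.
rewrite !mem_iota !ltnS leq_pmul2r // => le_ip.
by split=> //; apply/product_lengthP; exists i.
Qed.

Lemma size_forests_product_lengthS e n r k p : 0 < e ->
    n = k.+1 + r + p * e ->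
  size (forests (product_length e) n.+1 r.+1 k.+1) =
    size (forests (product_length e) n r k.+1) +
    \sum_(0 <= i < p.+1)
      size (forests (product_length e) n ((i * e).+1 + r) k).
Proof.
move=> e_gt0 nE; rewrite size_forestsSS; congr (_ + _).
apply: (sum_product_length (F := fun j => size (forests _ n (j + r) k))) => //.
  by lia.
by move=> j ltj; apply: size_forests_eq0 => //; lia.
Qed.

Lemma mul_bin_forest_step n r k s : n = k.+1 + r + s ->
  n.+1 * (r * (k.+1 * 'C(n, k.+1)) + (r.+1 * k.+1 + s) * 'C(n, k)) =
    n * (r.+1 * (k.+1 * 'C(n.+1, k.+1))).
Proof.
move=> nE; rewrite mul_bin_left -(mul_bin_diag n.+1) /=.
have -> : n - k = r.+1 + s by lia.
by rewrite nE; ring.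
Qed.

Lemma forests_cycle_lemma e n r k p : 0 < e -> n = k + r + p * e ->
  n * size (forests (product_length e) n r k) =
    r * 'C(n, k) * weak_compositions k p.
Proof.
move=> e_gt0; elim: n r k p => [|n IHn] r k p nE.
  by have -> : r = 0 by lia.
case: k nE => [|k] nE.
  rewrite size_forests0 bin0 weak_compositions0 nE add0n.
  case: p {nE} => [|p]; first by rewrite addn0 eqxx !muln1.
  by rewrite gtn_eqF ?muln0 // mulSn; lia.
case: r nE => [|r] nE; first by rewrite muln0.
have {}nE : n = k.+1 + r + p * e by lia.
rewrite (size_forests_product_lengthS e_gt0 nE).
set after_Indet := size _; set after_L := \sum_(_ <= _ < _) _.
set c := weak_compositions _ _.
have after_IndetE : n * after_Indet = r * 'C(n, k.+1) * c by exact: IHn.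
have after_LE : k.+1 * (n * after_L) = 'C(n, k) * ((r.+1 * k.+1 + e * p) * c).
  rewrite -sum_affine_weak_compositions [RHS]mulnCA; congr (_ * _).
  rewrite /after_L !big_distrr; apply: eq_big_nat => i /andP[_ le_ip] /=.
  by rewrite (IHn _ _ (p - i)); [ring | nia].
have n_gt0 : 0 < n by lia.
apply/eqP; rewrite -(eqn_pmul2l n_gt0) -(eqn_pmul2l (ltn0Sn k)); apply/eqP.
transitivity (n.+1 * (k.+1 * (n * after_Indet) + k.+1 * (n * after_L))).
  by ring.
rewrite after_IndetE after_LE.
transitivity (c * (n.+1 * (r * (k.+1 * 'C(n, k.+1)) +
                           (r.+1 * k.+1 + p * e) * 'C(n, k)))).
  by ring.
by rewrite (mul_bin_forest_step nE); ring.
Qed.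

Definition L_argument (M : expr) : option expr :=
  if M is [:: Lapp N] then Some N else None.

Lemma L_argumentK : ocancel L_argument (fun N => [:: Lapp N]).
Proof. by case=> [|[|N] [|f M]]. Qed.

(* q counts the products: a monomial with k L's and q products has q * d.-1 + 1
   indeterminates, hence k + 2 + q * d.-1 nodes once wrapped in one more L. *)
Definition L_trees (d k q : nat) : seq expr :=
  forests (product_length d.-1) (k.+2 + q * d.-1) 1 k.+1.

Definition monomials (d k q : nat) : seq expr :=
  pmap L_argument (L_trees d k q).

Lemma mem_monomials d k q M : 2 <= d ->
  (M \in monomials d k q) <->
    [/\ opmonomial d M, topt d M = k + q & lopt M = k].
Proof.
move=> d_ge2; have e_gt0 : 0 < d.-1 by lia.
have -> : (M \in monomials d k q) =
    is_forest (product_length d.-1) (k.+2 + q * d.-1) 1 k.+1 [:: Lapp M].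
  by rewrite (can2_mem_pmap L_argumentK) ?mem_forests.
rewrite /is_forest lopt_Lapp indets_Lapp cats0 eqSS all_seq1.
split=> [/and4P[_ /eqP nodesE /eqP loptE /(opmonomialP _ d_ge2) opM]|].
  have indetsE : indets M = (q * d.-1).+1 by lia.
  by split=> //; rewrite /topt loptE indetsE mulnK.
case=> opM; have [j jE] := opmonomial_indets d_ge2 opM.
rewrite /topt jE -pred_Sn mulnK // => toptE loptE.
have jq : j = q by lia.
apply/and4P; split; [by [] | | by rewrite loptE | exact/(opmonomialP _ d_ge2)].
by rewrite loptE jq addSn addnS addSn.
Qed.

Lemma uniq_monomials d k q : uniq (monomials d k q).
Proof. exact/(pmap_uniq L_argumentK)/uniq_forests. Qed.

Lemma size_monomials d k q : 2 <= d ->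
  (k + q).+1 * size (monomials d k q) =
    'C((k + q).+1, k.+1) * 'C(k.+1 + q * d.-1, k).
Proof.
move=> d_ge2; have e_gt0 : 0 < d.-1 by lia.
have sizeE : size (monomials d k q) = size (L_trees d k q).
  rewrite size_pmap; apply/eqP; rewrite -all_count; apply/allP => M.
  by rewrite mem_forests; case: M => [|[|N] [|f M]].
rewrite sizeE; pose n := k.+2 + q * d.-1.
have cycle : n * size (L_trees d k q) = 'C(n, k.+1) * 'C(k + q, k).
  rewrite (forests_cycle_lemma (p := q)) // ?addn1 //.
  rewrite mul1n weak_compositionsE addnC; congr (_ * _).
  by rewrite -bin_sub ?leq_addl // addnK.
have n_gt0 : 0 < n by [].
apply/eqP; rewrite -(eqn_pmul2l n_gt0) mulnCA cycle; apply/eqP.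
rewrite mulnCA [in RHS]mulnCA (mul_bin_diag n) (mul_bin_diag (k + q).+1).
by ring.
Qed.

Local Open Scope ring_scope.

Theorem theorem2p1 (d n k : nat) (hd : (2 <= d)%N) :
  exists s : seq expr,
    [/\ uniq s,
        forall M : expr,
          M \in s <-> [/\ opmonomial d M, topt d M = n & lopt M = k]
      & (size s)%:R = (n + 1)%:R^-1 * 'C(n + 1, k + 1)%:R
                      * 'C(n + (n - k) * (d - 2) + 1, k)%:R :> rat].
Proof.
have [lt_nk|/subnKC <-] := ltnP n k.
  exists [::]; split=> // [M|].
    by split=> // -[_ nE kE]; move: lt_nk; rewrite -nE -kE ltnNge leq_addr.
  by rewrite bin_small ?ltn_add2r // mulr0 mul0r.
move: (n - k)%N => q; exists (monomials d k q); split=> [|M|].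
- exact: uniq_monomials.
- exact: mem_monomials.
have -> : (k + q + (k + q - k) * (d - 2) + 1 = k.+1 + q * d.-1)%N by nia.
rewrite -mulrA !addn1 -natrM -size_monomials // natrM mulKf //.
by rewrite pnatr_eq0.
Qed.
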